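(* Let $n\ge 1$ and let $\mathcal{S}_n\subseteq\mathcal{M}_n$ be the family of $n\times n$ complex scalar matrices. Then $\mathcal{S}_n$ and $\mathcal{M}_n$ form a multiplicative finite free complementary pair, i.e. $\mathcal{S}_n^{\boxtimes}=\mathcal{M}_n$ and $\mathcal{M}_n^{\boxtimes}=\mathcal{S}_n$.
   Context: $\mathcal{M}_n=\mathbb{C}^{n\times n}$ and $\chi_A(x)=\det(xI-A)$. A scalar matrix is a matrix $\lambda I$ with $\lambda\in\mathbb{C}$. For polynomials $p(x)=\sum_{k=0}^n a_kx^{n-k}$ and $q(x)=\sum_{k=0}^n b_kx^{n-k}$ of degree $n$ over $\mathbb{C}$, the multiplicative convolution is $p(x)\boxtimes q(x)=\sum_{k=0}^n\frac{(-1)^k}{\binom{n}{k}}a_kb_kx^{n-k}$. For $\mathcal{A}\subseteq\mathcal{M}_n$, $\mathcal{A}^{\boxtimes}$ is the set of all $B\in\mathcal{M}_n$ such that $\chi_{AB}(x)=\chi_A(x)\boxtimes\chi_B(x)$ for every $A\in\mathcal{A}$. Sets $\mathcal{E},\mathcal{F}\subseteq\mathcal{M}_n$ form a multiplicative finite free complementary pair if $\mathcal{E}^{\boxtimes}=\mathcal{F}$ and $\mathcal{F}^{\boxtimes}=\mathcal{E}$. *)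

(* Defs.v *)
From HB Require Import structures.
From mathcomp Require Import all_boot all_order all_algebra.
From mathcomp Require Import complex.
From mathcomp Require Import classical_sets reals.

Set Implicit Arguments.
Unset Strict Implicit.
Unset Printing Implicit Defensive.

Import GRing.Theory.

Local Open Scope ring_scope.
Local Open Scope classical_set_scope.
Local Open Scope complex_scope.

Section MultiplicativeFiniteFree.

(* R is the field of real numbers, so that R[i] is the field of complex
   numbers. *)
Variables (R : realType) (n : nat).

(* Meaningful for p and q of degree n.  The coefficient of a polynomial with
   index k in the descending convention p = \sum_k a_k 'X^(n - k) is
   a_k = p`_(n - k). *)
Definition mult_conv (p q : {poly R[i]}) : {poly R[i]} :=
  \sum_(k < n.+1)
    ((-1) ^+ k / 'C(n, k)%:R * p`_(n - k) * q`_(n - k)) *: 'X^(n - k).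

Definition mult_dual (A : set 'M[R[i]]_n) : set 'M[R[i]]_n :=
  [set Y | forall X, A X ->
     char_poly (X *m Y) = mult_conv (char_poly X) (char_poly Y)].

Definition mult_complementary_pair (E F : set 'M[R[i]]_n) : Prop :=
  mult_dual E = F /\ mult_dual F = E.

Definition scalar_matrices : set 'M[R[i]]_n :=
  [set X | exists a : R[i], X = a%:M].

End MultiplicativeFiniteFree.

Arguments scalar_matrices : clear implicits.

(* Main.v *)
Require Import Defs.
From mathcomp Require Import all_boot all_order all_algebra.
From mathcomp Require Import complex.
From mathcomp Require Import classical_sets reals.

Import GRing.Theory Num.Theory.

Local Open Scope ring_scope.
Local Open Scope classical_set_scope.
Local Open Scope complex_scope.

(** Write chi_Y = \sum_k b_k 'X^(n - k).  Since chi_(aI) = ('X - a)^n, its k-th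
    coefficient is (-1)^k 'C(n, k) a^k, which is exactly what the weight
    (-1)^k / 'C(n, k) of the convolution cancels: chi_(aI) convolved with chi_Y
    is \sum_k a^k b_k 'X^(n - k).  By homogeneity of the characteristic
    polynomial this is chi_(aY) ([coef_char_poly_scale]).  So a scalar matrix
    satisfies the convolution identity with every matrix
    ([char_poly_scalar_mul]). This yields the dual of the scalars; since aI
    commutes with every matrix and the convolution is commutative, it also
    yields one inclusion for the dual of all matrices.

    For the other inclusion the coefficient of 'X^(n - 1) suffices: it turns
    the convolution identity into \tr (X Y) = \tr X * \tr Y / n
    ([mxtrace_mul_of_mult_conv]).  If this holds for every X, the elementary
    matrices X = E_ij read off the entries of Y: they vanish off the diagonal
    and equal \tr Y / n on it. *)

Lemma coef_comp_polyZX (R : comNzRingType) (a : R) (p : {poly R}) (j : nat) :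
  (p \Po (a *: 'X))`_j = a ^+ j * p`_j.
Proof.
have -> : p \Po (a *: 'X) = \poly_(i < size p) (a ^+ i * p`_i).
  rewrite comp_polyE poly_def; apply: eq_bigr => i _.
  by rewrite exprZn scalerA mulrC.
by rewrite coef_poly; case: ltnP => // le_pj; rewrite nth_default ?mulr0.
Qed.

(** Substituting a 'X for 'X in det ('X I - a Y) pulls a factor a out of each
    row; comparing coefficients and cancelling a power of a gives the claim for
    a != 0.  For a = 0 both sides vanish except at the leading coefficient. *)
Lemma coef_char_poly_scale (F : fieldType) (n : nat) (a : F) (Y : 'M[F]_n)
    (k : nat) : (k <= n)%N ->
  (char_poly (a *: Y))`_(n - k) = a ^+ k * (char_poly Y)`_(n - k).
Proof.
move=> le_kn; have [->|a_neq0] := eqVneq a 0.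
  have -> : char_poly (0 *: Y) = 'X^n.
    by rewrite scale0r /char_poly /char_poly_mx map_mx0 subr0 det_scalar.
  rewrite coefXn; case: k le_kn => [|k] le_kn.
    have /monicP := char_poly_monic Y.
    by rewrite lead_coefE size_char_poly subn0 eqxx expr0 mul1r => ->.
  by rewrite expr0n /= mul0r ltn_eqF // ltn_subrL (leq_ltn_trans _ le_kn).
have comp_scale : char_poly (a *: Y) \Po (a *: 'X) = a ^+ n *: char_poly Y.
  rewrite /char_poly -[LHS](det_map_mx (comp_poly (a *: 'X))).
  rewrite -[RHS]mul_polyC rmorphXn /= -detZ; congr (\det _).
  apply/matrixP=> i j; rewrite !mxE rmorphB rmorphMn /= comp_polyX comp_polyC.
  by rewrite mulrBr polyCM mulrnAr !mul_polyC.
have := congr1 (fun p : {poly F} => p`_(n - k)) comp_scale.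
have -> : a ^+ n = a ^+ (n - k) * a ^+ k by rewrite -exprD subnK.
rewrite coef_comp_polyZX coefZ -mulrA.
by apply: mulfI; rewrite expf_neq0.
Qed.

(** The binomial expansion of ('X - a)^n: only the term of index k contributes. *)
Lemma coef_char_poly_scalar (R : comNzRingType) (n : nat) (a : R) (k : nat) :
  (k <= n)%N ->
  (char_poly (a%:M : 'M_n))`_(n - k) = (-1) ^+ k * 'C(n, k)%:R * a ^+ k.
Proof.
move=> le_kn; rewrite /char_poly /char_poly_mx map_scalar_mx -raddfB det_scalar.
rewrite -polyCN exprDn coef_sum (bigD1 (Ordinal (le_kn : (k < n.+1)%N))) //=.
rewrite -rmorphXn /= coefMn coefMC coefXn eqxx mul1r big1 ?addr0.
  by rewrite [in LHS]exprNn -[LHS]mulr_natr mulrAC.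
move=> i ne_ik; rewrite -rmorphXn /= coefMn coefMC coefXn.
suff /negPf -> : (n - k)%N != (n - i)%N by rewrite mul0r mul0rn.
apply: contra_neq ne_ik => eq_nki; apply: val_inj.
by rewrite /= -(subKn le_kn) eq_nki subKn // -ltnS.
Qed.

(** Ascending indexing makes the coefficients directly readable, including their
    vanishing beyond degree n. *)
Lemma mult_convE (R : realType) (n : nat) (p q : {poly R[i]}) :
  mult_conv n p q =
  \poly_(j < n.+1) ((-1) ^+ (n - j) / 'C(n, n - j)%:R * p`_j * q`_j).
Proof.
rewrite /mult_conv (reindex_inj rev_ord_inj) poly_def.
apply: eq_bigr => j _; rewrite /= subSS subKn //.
by rewrite -ltnS.
Qed.

Lemma mult_convC (R : realType) (n : nat) (p q : {poly R[i]}) :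
  mult_conv n p q = mult_conv n q p.
Proof. by apply: eq_bigr => k _; rewrite mulrAC. Qed.

Lemma char_poly_scalar_mul (R : realType) (n : nat) (a : R[i]) (Y : 'M_n) :
  char_poly (a%:M *m Y) = mult_conv n (char_poly (a%:M : 'M_n)) (char_poly Y).
Proof.
rewrite mul_scalar_mx mult_convE; apply/polyP => j; rewrite coef_poly ltnS.
case: leqP => [le_jn|lt_nj]; last by rewrite nth_default ?size_char_poly.
rewrite -(subKn le_jn); move: (n - j)%N (leq_subr j n) => k le_kn.
rewrite coef_char_poly_scale // coef_char_poly_scalar // subKn //.
have bin_neq0 : 'C(n, k)%:R != 0 :> R[i] by rewrite pnatr_eq0 -lt0n bin_gt0.
rewrite mulrA; congr (_ * _).
rewrite -!mulrA (mulrCA 'C(n, k)%:R^-1) mulKf // mulrA.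
by rewrite -exprMn mulrN1 opprK expr1n mul1r.
Qed.

(** The coefficient of 'X^(n - 1) in a characteristic polynomial is minus the
    trace, and its weight in the convolution is -1 / n. *)
Lemma mxtrace_mul_of_mult_conv (R : realType) (n : nat) (X Y : 'M[R[i]]_n) :
  (0 < n)%N ->
  char_poly (X *m Y) = mult_conv n (char_poly X) (char_poly Y) ->
  \tr (X *m Y) = \tr X * \tr Y / n%:R.
Proof.
move=> n_gt0 /(congr1 (fun p : {poly R[i]} => p`_n.-1)).
rewrite mult_convE coef_poly ltnS leq_pred !char_poly_trace //.
have -> : (n - n.-1 = 1)%N by rewrite -subn1 subKn.
rewrite bin1 expr1 !mulrN !mulNr mul1r opprK => /oppr_inj ->.
by rewrite -mulrA mulrC.
Qed.

Lemma mxtrace_delta_mul (R : comNzRingType) (n : nat) (i j : 'I_n)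
    (Y : 'M[R]_n) : \tr (delta_mx j i *m Y) = Y i j.
Proof.
rewrite -(mul_delta_mx (0 : 'I_1)) -mulmxA mxtrace_mulC -rowE -colE.
by rewrite trace_mx11 !mxE.
Qed.

Theorem theorem6p14 (R : realType) (n : nat) (hn : (1 <= n)%N) :
  mult_complementary_pair (scalar_matrices R n) [set: 'M[R[i]]_n].
Proof.
split; apply/seteqP; split=> Y /=.
- by [].
- by move=> _ _ [a ->]; exact: char_poly_scalar_mul.
- move=> dualY; exists (\tr Y / n%:R); apply/matrixP=> i j.
  have := mxtrace_mul_of_mult_conv R n (delta_mx j i) Y hn (dualY _ Logic.I).
  (* The trace of delta_mx j i is the same formula, read at the identity matrix. *)
  rewrite mxtrace_delta_mul -(mulmx1 (delta_mx j i)) mxtrace_delta_mul => ->.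
  by rewrite !mxE -mulrA mulr_natl.
- move=> [a ->] X _; rewrite scalar_mxC mult_convC.
  exact: char_poly_scalar_mul.
Qed.
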